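(* Let $q$ be a prime power, let $p$ be the characteristic of $\mathbb{F}_q$, let $n$ be a positive integer, and write $n=p^s n_0$ with $s\ge 0$ and $\gcd(n_0,p)=1$. Let $d$ be the least positive integer such that $q^d\equiv 1\pmod{n_0}$. For each positive integer $r$ let $v_r$ be the number of distinct monic irreducible factors of degree $r$ of $x^n-1$ over $\mathbb{F}_q$. Then the number $N_2$ of $2$-normal elements of $\mathbb{F}_{q^n}$ over $\mathbb{F}_q$ is $$N_2=\begin{cases}\left(v_1+\frac12 v_1(v_1-1)+v_2\right)q^{n-n_0-2}\displaystyle\prod_{r\mid d}(q^r-1)^{v_r} & \text{if } n\neq n_0 \text{ and } p^s>2,\\[2ex] \left(\frac{q}{q-1}v_1+\frac12 v_1(v_1-1)+v_2\right)q^{n-n_0-2}\displaystyle\prod_{r\mid d}(q^r-1)^{v_r} & \text{if } n\neq n_0 \text{ and } p^s=2,\\[2ex] \left(\dfrac{v_1(v_1-1)}{2(q-1)^2}+\dfrac{v_2}{q^2-1}\right)\displaystyle\prod_{r\mid d}(q^r-1)^{v_r} & \text{if } n=n_0.\end{cases}$$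
   Context: For $\alpha\in\mathbb{F}_{q^n}$ put $g_\alpha(x)=\sum_{i=0}^{n-1}\alpha^{q^i}x^{n-1-i}\in\mathbb{F}_{q^n}[x]$. For $0\le k\le n$, the element $\alpha$ is called $k$-normal over $\mathbb{F}_q$ if $\gcd(x^n-1,g_\alpha(x))$, computed over $\mathbb{F}_{q^n}$, has degree $k$; here $\gcd(x^n-1,0)=x^n-1$, so $\alpha=0$ is the unique $n$-normal element (and there are no $k$-normal elements for $k>n$). Products over $r\mid d$ run over the positive divisors $r$ of $d$. The formulas are identities of rational numbers (exponents of $q$ may be negative). *)

(* Defs.v *)
From mathcomp Require Import all_boot all_order all_algebra all_field.

Set Implicit Arguments.
Unset Strict Implicit.
Unset Printing Implicit Defensive.

Import GRing.Theory.

Local Open Scope ring_scope.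

Definition g_poly (F : finFieldType) (L : fieldExtType F) (a : L) : {poly L} :=
  let n := \dim {:L} in
  \sum_(i < n) (a ^+ (#|F| ^ i)%N) *: 'X^(n - 1 - i).

(* [gcdp] is only determined up to a nonzero scalar, which does not affect its
   degree; it is nonzero here since 'X^n - 1 is, so its size is its degree
   plus one. *)
Definition k_normal (F : finFieldType) (L : fieldExtType F) (k : nat) (a : L)
    : bool :=
  size (gcdp ('X^(\dim {:L}) - 1) (g_poly a)) == k.+1.

(* [finvect_type L] is L itself, with its structure of finite type. *)
Definition num_k_normal (F : finFieldType) (L : fieldExtType F) (k : nat) : nat :=
  #|[set a : finvect_type L | k_normal k (a : L)]|.

(* {poly_r.+1 F} is the finite type of polynomials of size at most r.+1,
   that is of degree at most r. *)
Definition num_irr_factors (F : finFieldType) (n r : nat) : nat :=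
  #|[set f : {poly_(r.+1) F} |
      [&& (f : {poly F}) \is monic, irreducibleb (f : {poly F}),
          size (f : {poly F}) == r.+1 & (f : {poly F}) %| 'X^n - 1]]|.

(* Main.v *)
(** Write q for the order of F, n for the degree of L and frob for x |-> x^q.
    Modulo X^n - 1, multiplying g_a by c in F[X] gives g_b, where b is the image
    of a under c(frob). Hence, for h * c = X^n - 1, h divides g_a iff c(frob)
    kills a. The kernel of c(frob) has dimension at most deg c, being the set of
    roots of a polynomial of degree q^(deg c), and exactly deg c by rank-nullity
    applied to the factorisation of X^n - 1; no normal basis is needed. So there
    are q^(n - deg h) elements a with h | g_a, and inclusion-exclusion over the
    irreducible f with h * f | X^n - 1 counts those for which the gcd is exactly
    h. This gcd is always defined over F because frob maps g_a to X * g_a modulo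
    X^n - 1. It remains to sum over the monic divisors h of degree 2 of
    X^n - 1 = (X^n0 - 1)^(p^s), which are either irreducible, or a product of two
    distinct linear factors, or the square of one when p^s > 1. *)
From HB Require Import structures.
Require Import Defs.
From mathcomp Require Import all_boot all_order all_algebra all_field.
From mathcomp Require Import zify ring.

Set Implicit Arguments.
Unset Strict Implicit.
Unset Printing Implicit Defensive.

Import Order.TTheory GRing.Theory Num.Theory FalgLfun.

Local Open Scope ring_scope.

(** Supplies the side condition of [exprDn_pchar], which makes the q-power map additive on [L]. *)
Lemma pnat_card_finField (F : finFieldType) (R : nzRingType) :
  [pchar F] =i [pchar R] -> [pchar R].-nat #|F|.
Proof.
move=> eqch; have [p p_pr pF] := finPcharP F.
rewrite (card_pprimeChar pF : #|F| = _) pnatX; apply/orP; left.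
by rewrite pnatE // -eqch.
Qed.

Lemma map_Xn_sub_1 (R S : nzRingType) (f : {rmorphism R -> S}) m :
  map_poly f ('X^m - 1) = 'X^m - 1.
Proof. by rewrite rmorphB rmorph1 /= map_polyXn. Qed.

(** * The action of F[X] on L through Frobenius, and the polynomials g_a *)

Section Frobenius.

Variables (F : finFieldType) (L : fieldExtType F).

Local Notation q := #|F|.
Local Notation n := (\dim {:L}).
Local Notation "p ^L" := (map_poly (in_alg L) p)
  (at level 2, left associativity, format "p ^L").
Local Notation cyc R := ('X^n - 1 : {poly R}).

Definition frob (x : L) : L := x ^+ q.

Fact frob_is_linear : linear frob.
Proof.
move=> a x y; rewrite /frob exprDn_pchar ?exprZn ?expf_card //.
by apply: pnat_card_finField => p; rewrite pchar_lalg.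
Qed.
HB.instance Definition _ := GRing.isLinear.Build F L L _ frob frob_is_linear.

Fact frob_is_monoid_morphism : monoid_morphism frob.
Proof. by split=> [|x y]; rewrite /frob ?expr1n ?exprMn. Qed.
HB.instance Definition _ :=
  GRing.isMonoidMorphism.Build L L frob frob_is_monoid_morphism.

Lemma iter_frob i x : iter i frob x = x ^+ (q ^ i).
Proof. by elim: i => [|i IHi] /=; rewrite ?expn0 ?expr1 // IHi /frob -exprM -expnSr. Qed.

Lemma iter_frob_dim x : iter n frob x = x.
Proof.
by apply/eqP; rewrite iter_frob -(Fermat's_little_theorem {:L}%AS) memvf.
Qed.

Lemma frob_fixed x : frob x = x -> exists a : F, x = a%:A.
Proof.
move=> fx; suff /vlineP: x \in (1%AS : {vspace L}) by [].
by rewrite (Fermat's_little_theorem 1%AS) dimv1 expn1; apply/eqP.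
Qed.

Definition frob_act (c : {poly F}) : 'End(L) := horner_alg (linfun frob) c.

Lemma frob_actM c h x : frob_act (c * h) x = frob_act c (frob_act h x).
(* The product of ['End(L)] composes from left to right, hence the swap. *)
Proof. by rewrite mulrC /frob_act rmorphM lfun_mulE. Qed.

Lemma frob_actE c x : frob_act c x = \sum_(i < size c) c`_i *: x ^+ (q ^ i).
Proof.
have frobX i : (linfun frob ^+ i) x = x ^+ (q ^ i).
  elim: i => [|i IHi]; first by rewrite expr0 id_lfunE expr1.
  by rewrite exprSr lfun_mulE IHi lfunE /= /frob -exprM -expnSr.
rewrite /frob_act -[c in horner_alg _ c]coefK poly_def rmorph_sum /= sum_lfunE.
apply: eq_bigr => i _.
by rewrite linearZ /= mulr_algl rmorphXn /= horner_algX scale_lfunE frobX.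
Qed.

Local Notation g_poly := (@g_poly F L).

Lemma coef_g_poly x i : (g_poly x)`_i = if (i < n)%N then iter (n - 1 - i) frob x else 0.
Proof.
rewrite /g_poly (reindex_inj rev_ord_inj) /=.
rewrite (eq_bigr (fun j : 'I_n => iter (n - 1 - j) frob x *: 'X^j)).
  by rewrite -(poly_def _ (fun j => iter (n - 1 - j) frob x)) coef_poly.
move=> j _; have lt_j_n := ltn_ord j.
rewrite iter_frob; congr (_ ^+ (_ ^ _) *: 'X^_); move: lt_j_n; lia.
Qed.

Lemma size_g_poly x : (size (g_poly x) <= n)%N.
Proof.
by apply/leq_sizeP => i le_n_i; rewrite coef_g_poly ltnNge le_n_i.
Qed.

Fact g_poly_is_zmod_morphism : zmod_morphism g_poly.
Proof.
have iterB i : zmod_morphism (iter i frob).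
  by elim: i => // i IHi x y; rewrite /= IHi raddfB.
move=> x y; apply/polyP => i; rewrite coefB !coef_g_poly.
by case: ifP => _; rewrite ?subr0 ?iterB.
Qed.
HB.instance Definition _ :=
  GRing.isZmodMorphism.Build L {poly L} g_poly g_poly_is_zmod_morphism.

Lemma g_polyZ a x : g_poly (a *: x) = a%:A *: g_poly x.
Proof.
have iterZ i : iter i frob (a *: x) = a *: iter i frob x.
  by elim: i => //= i ->; rewrite linearZ.
apply/polyP => i; rewrite coefZ !coef_g_poly iterZ mulr_algl.
by case: ifP; rewrite ?scaler0.
Qed.

Lemma g_poly_frob x : g_poly (frob x) = map_poly frob (g_poly x).
Proof.
apply/polyP => i; rewrite coef_map !coef_g_poly -iterSr.
by case: ifP => _; rewrite ?raddf0.
Qed.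

Let n_gt0 : (0 < n)%N.
Proof. exact: (adim_gt0 {:L}%AS). Qed.

(** Raising indices by one amounts to applying [frob] to every coefficient, except at the two ends:
    the coefficient [x] of X^(n-1) moves up to degree n, while [g_poly (frob x)] has the constant
    term frob^n x = x. The multiple of X^n - 1 accounts for both. *)
Lemma g_poly_shift x : 'X * g_poly x = g_poly (frob x) + x *: cyc L.
Proof.
apply/polyP=> i; rewrite coefD coefXM coefZ coefB coefXn coef1 !coef_g_poly.
case: i => [|i] /=; rewrite -!iterSr.
  rewrite n_gt0 (ltn_eqF n_gt0) sub0r mulrN1.
  by rewrite (_ : (n - 1 - 0).+1 = n) ?iter_frob_dim ?subrr //; lia.
rewrite subr0; case: (ltngtP i.+1 n) => [lt_i_n|gt_i_n|eq_i_n].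
- by rewrite mulr0 addr0; congr (iter _ _ _); lia.
- by rewrite mulr0 addr0.
by rewrite mulr1 add0r (_ : (n - 1 - i)%N = 0%N) //; lia.
Qed.

(** Horner induction on [c]: the shift identity absorbs a factor X up to a multiple of X^n - 1, and
    linearity of [g_poly] absorbs the constant term. *)
Lemma g_poly_act c x : cyc L %| c^L * g_poly x - g_poly (frob_act c x).
Proof.
elim/poly_ind: c x => [|c a IHc] x.
  by rewrite rmorph0 mul0r /frob_act rmorph0 zero_lfunE raddf0 subr0 dvdp0.
have -> : frob_act (c * 'X + a%:P) x = frob_act c (frob x) + a *: x.
  rewrite /frob_act rmorphD /= add_lfunE -/(frob_act _) frob_actM /frob_act.
  by rewrite horner_algX horner_algC scale_lfunE id_lfunE lfunE.
rewrite rmorphD rmorphM /= map_polyX map_polyC /= mulrDl -mulrA g_poly_shift.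
rewrite mul_polyC -g_polyZ [g_poly (_ + _)]raddfD /= mulrDr.
have subA (A B C D : {poly L}) : A + B + C - (D + C) = A - D + B.
  by rewrite addrAC opprD addrA addrAC addrK addrAC.
by rewrite subA dvdp_add // -scalerAr -mul_polyC !dvdp_mull.
Qed.

Let size_cyc (R : nzRingType) : size (cyc R) = n.+1.
Proof. by rewrite size_XnsubC. Qed.

Let cyc_neq0 (R : nzRingType) : cyc R != 0.
Proof. by rewrite -size_poly_eq0 size_cyc. Qed.

(** Since [g_poly x] has degree below n, divisibility forces it to vanish, and its coefficient of
    X^(n-1) is [x] itself. *)
Lemma dvdp_cyc_g_poly x : (cyc L %| g_poly x) = (x == 0).
Proof.
apply/idP/eqP => [cyc_dvd|->]; last by rewrite raddf0 dvdp0.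
have gx0 : g_poly x = 0.
  apply/eqP/negPn/negP => /dvdp_leq/(_ cyc_dvd).
  by rewrite size_cyc leqNgt ltnS size_g_poly.
have := coef_g_poly x (n - 1); rewrite gx0 coef0 subnn /= ifT //; lia.
Qed.

Lemma frob_act_eq0 c x : (frob_act c x == 0) = (cyc L %| c^L * g_poly x).
Proof.
rewrite -dvdp_cyc_g_poly -[c^L * _](subrK (g_poly (frob_act c x))).
by rewrite dvdp_addr // g_poly_act.
Qed.

Lemma dim_lker_frob_act_leq c : c != 0 -> (\dim (lker (frob_act c)) <= (size c).-1)%N.
Proof.
move=> c_neq0; have [q_gt1 sz_c] := (finNzRing_gt1 F, size_poly_gt0 c).
(* The linearized polynomial (q-associate) of [c]: evaluating it at [x] gives [frob_act c x]. Its
   degree is q^(deg c), so it has at most that many roots, whereas the kernel has q^dim elements. *)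
pose l : {poly L} := \sum_(i < size c) (c`_i)%:A *: 'X^(q ^ i).
have szc : ((size c).-1 < size c)%N by rewrite ltn_predL sz_c.
have l_neq0 : l != 0.
  apply/eqP => /(congr1 (fun r : {poly L} => r`_(q ^ (size c).-1))).
  rewrite coef0 coef_sum (bigD1 (Ordinal szc)) //= coefZ coefXn eqxx mulr1 big1 ?addr0.
    by move/eqP; rewrite scaler_eq0 oner_eq0 orbF lead_coef_eq0 (negPf c_neq0).
  move=> i ne_i; rewrite coefZ coefXn eqn_exp2l // eq_sym.
  by rewrite -[_ == _]/(i == Ordinal szc) (negPf ne_i) mulr0.
have sz_l : (size l <= (q ^ (size c).-1).+1)%N.
  apply: leq_trans (size_sum _ _ _) _; apply/bigmax_leqP => i _.
  apply: leq_trans (size_scale_leq _ _) _.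
  by rewrite size_polyXn ltnS leq_exp2l // -ltnS prednK // sz_c.
pose V : {vspace finvect_type L} := lker (frob_act c).
rewrite -(leq_exp2l _ _ q_gt1) -(card_vspace V) -ltnS.
apply: leq_trans sz_l; rewrite cardE; apply: max_poly_roots => //; last exact: enum_uniq.
apply/allP => x; rewrite mem_enum memv_ker frob_actE => /eqP lx0.
apply/rootP; rewrite -[RHS]lx0 horner_sum; apply: eq_bigr => i _.
by rewrite hornerZ hornerXn mulr_algl.
Qed.

(** With X^n - 1 = h * c, the image of [frob_act c] lies in the kernel of [frob_act h], so n <= dim
    ker c(frob) + deg h by rank-nullity and the bound for [h]. This gives the lower bound deg c. *)
Lemma dim_lker_frob_act c : c %| cyc F -> \dim (lker (frob_act c)) = (size c).-1.
Proof.
move=> /dvdpP[h Dcyc]; have := cyc_neq0 F; rewrite Dcyc mulf_eq0 negb_or => /andP[h0 c0].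
have le_img : (\dim (limg (frob_act c)) <= \dim (lker (frob_act h)))%N.
  apply: dimvS; apply/subvP => _ /memv_imgP[x _ ->]; rewrite memv_ker.
  by rewrite -frob_actM -Dcyc frob_act_eq0 map_Xn_sub_1 dvdp_mulr.
apply/eqP; rewrite eqn_leq dim_lker_frob_act_leq //=.
have := limg_ker_dim (frob_act c) {:L}; rewrite capfv.
have := dim_lker_frob_act_leq h0; have := size_mul h0 c0.
have: (0 < size h)%N by rewrite size_poly_gt0.
rewrite -Dcyc size_cyc; move: le_img.
move: (\dim _) (\dim (limg _)) (\dim (lker (frob_act c))) => a b d.
move: n => N; move: (size c) (size h) => u v; lia.
Qed.

(** For the cofactor [c] of [h], the condition on [x] amounts to X^n - 1 dividing c * g_x, that is,
    to [x] lying in the kernel of [frob_act c]. The exponent is n - deg h = deg c. *)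
Lemma card_dvd_g_poly h : h %| cyc F ->
  #|[set x : finvect_type L | h^L %| g_poly x]| = (q ^ (n.+1 - size h))%N.
Proof.
move=> /dvdpP[c Dcyc]; have := cyc_neq0 F; rewrite Dcyc mulf_eq0 negb_or => /andP[c0 h0].
pose V : {vspace finvect_type L} := lker (frob_act c).
rewrite cardsE (_ : #|_| = #|V|).
  rewrite card_vspace dim_lker_frob_act; last by rewrite Dcyc dvdp_mulr.
  by have := size_mul c0 h0; rewrite -Dcyc size_cyc => ?; congr (_ ^ _)%N; lia.
apply: eq_card => x; rewrite memv_ker frob_act_eq0 -(map_Xn_sub_1 (in_alg L)) Dcyc.
by rewrite rmorphM /= dvdp_mul2l ?map_poly_eq0.
Qed.

(** Frobenius on coefficients fixes X^n - 1 and turns g_x into X * g_x modulo X^n - 1. As X is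
    coprime to X^n - 1, the gcd is preserved up to a scalar; once made monic it is fixed, so its
    coefficients lie in [F]. *)
Lemma gcdp_g_poly_rational x :
  exists2 h : {poly F}, h \is monic /\ h %| cyc F & gcdp (cyc L) (g_poly x) %= h^L.
Proof.
set D := gcdp _ _; have D0 : D != 0 by rewrite gcdp_eq0 negb_and cyc_neq0.
have lD0 : (lead_coef D)^-1 != 0 by rewrite invr_eq0 lead_coef_eq0.
pose u := (lead_coef D)^-1 *: D.
have mu : u \is monic by rewrite monicE lead_coefZ mulVf // lead_coef_eq0.
have uD : u %= D by rewrite eqp_scale.
have frob_u : map_poly frob u = u.
  apply/eqP; rewrite -eqp_monic ?map_monic //; apply: eqp_trans (_ : D %= u); last by rewrite eqp_sym.
  have /eqp_trans-> // : map_poly frob u %= map_poly frob D by rewrite eqp_map.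
  rewrite gcdp_map map_Xn_sub_1 -g_poly_frob.
  have -> : g_poly (frob x) = 'X * g_poly x - x *: cyc L by rewrite g_poly_shift addrK.
  rewrite -scaleNr -mul_polyC [X in gcdp _ X]addrC (eqp_ltrans (gcdp_addl_mul _ _ _)).
  apply: Gauss_gcdpr; rewrite coprimepX /root !hornerE.
  by rewrite expr0n (gtn_eqF n_gt0) sub0r oppr_eq0 oner_eq0.
have /polyOver1P[h Du] : u \is a polyOver 1%VS.
  apply/polyOverP => i; have : frob u`_i = u`_i by rewrite -coef_map frob_u.
  by move=> /frob_fixed[a ->]; rewrite rpredZ ?mem1v.
exists h; last by rewrite -Du eqp_sym.
split; first by rewrite -(map_monic (in_alg L)) -Du.
by rewrite -(dvdp_map (in_alg L)) -Du map_Xn_sub_1 (eqp_dvdl _ uD) dvdp_gcdl.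
Qed.

End Frobenius.

(** * Coprimality and irreducible factors over a finite field *)

Lemma dvdp_mul_coprime (R : fieldType) (h a b p : {poly R}) : h != 0 -> coprimep a b ->
  (h * a * b %| p) = (h * a %| p) && (h * b %| p).
Proof.
move=> h0 co_ab; have [/dvdpP[w ->]|h_ndvd] := boolP (h %| p).
  by rewrite -mulrA ![h * _]mulrC !dvdp_mul2r // Gauss_dvdp.
have ndvd c : (h * c %| p) = false.
  by apply: contraNF h_ndvd; apply: dvdp_trans; rewrite dvdp_mulr.
by rewrite -mulrA !ndvd.
Qed.

Lemma monic_irreducible_factor (F : finFieldType) (p : {poly F}) :
  (1 < size p)%N -> exists f : {poly F}, [/\ f \is monic, irreducible_poly f & f %| p].
Proof.
move=> p_gt1; have p0 : p != 0 by rewrite -size_poly_gt0 ltnW.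
(* A nonconstant divisor of least degree is irreducible; size [k.+2] excludes the constants, and
   bounding the size makes the existence of such a divisor decidable. *)
pose P k := [exists r : {poly_(size p) F}, (size (r : {poly F}) == k.+2) && ((r : {poly F}) %| p)].
have exP : exists k, P k.
  exists (size p).-2; apply/existsP; exists (NPoly (leqnn (size p))) => /=.
  by rewrite dvdpp andbT; move: p_gt1; case: (size p) => [|[]].
case: (ex_minnP exP) => k /existsP[r /andP[/eqP sz_r r_dvd]] min_k.
have r0 : (r : {poly F}) != 0 by rewrite -size_poly_gt0 sz_r.
have lr0 : (lead_coef r)^-1 != 0 by rewrite invr_eq0 lead_coef_eq0.
exists ((lead_coef r)^-1 *: (r : {poly F})); split; last by rewrite dvdpZl.
  by rewrite monicE lead_coefZ mulVf // lead_coef_eq0.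
split=> [|d sz_d]; rewrite ?size_scale ?sz_r // dvdpZr // => d_dvd.
rewrite eqp_sym (eqp_ltrans (eqp_scale _ lr0)) eqp_sym -dvdp_size_eqp // sz_r.
have d_dvd_p := dvdp_trans d_dvd r_dvd.
have d0 : d != 0 by apply: contraTneq d_dvd => ->; rewrite dvd0p.
have sz_d_gt1 : (1 < size d)%N by rewrite ltn_neqAle eq_sym sz_d size_poly_gt0.
have Pd : P (size d).-2.
  apply/existsP; exists (NPoly (dvdp_leq p0 d_dvd_p : d \is a poly_of_size (size p))) => /=.
  by rewrite d_dvd_p andbT; move: sz_d_gt1; case: (size d) => [|[]].
have := min_k _ Pd; have := dvdp_leq r0 d_dvd; rewrite sz_r; lia.
Qed.

(** Bounding the size by that of [p] makes the enumeration finite, and loses no divisor when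
    [p != 0]. *)
Definition irr_factors (F : finFieldType) (p : {poly F}) : seq {poly F} :=
  [seq val f | f : {poly_(size p) F} in
    [pred f | [&& val f \is monic, irreducibleb (val f) & val f %| p]]].

Lemma mem_irr_factors (F : finFieldType) (p f : {poly F}) : p != 0 ->
  reflect [/\ f \is monic, irreducible_poly f & f %| p] (f \in irr_factors p).
Proof.
move=> p0; apply: (iffP imageP) => [[r /and3P[mr /irreducibleP ir r_dvd] ->] //|[mf /irreducibleP irf f_dvd]].
by exists (NPoly (dvdp_leq p0 f_dvd : f \is a poly_of_size (size p))); rewrite // inE /= mf irf.
Qed.

Lemma irr_factors_uniq (F : finFieldType) (p : {poly F}) : uniq (irr_factors p).
Proof. by rewrite map_inj_uniq ?enum_uniq //; apply: val_inj. Qed.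

Lemma irr_factors_coprime (F : finFieldType) (p : {poly F}) : p != 0 ->
  {in irr_factors p &, forall f g, f != g -> coprimep f g}.
Proof.
move=> p0 f g /(mem_irr_factors _ p0)[mf irf _] /(mem_irr_factors _ p0)[mg irg _].
rewrite irreducible_poly_coprime //; apply: contraNN => f_dvd.
by rewrite -eqp_monic //; case: irg => _; apply=> //; case: irf => /gtn_eqF ->.
Qed.

Lemma irr_factors_pairwise_coprime (F : finFieldType) (p : {poly F}) :
  p != 0 -> pairwise (@coprimep F) (irr_factors p).
Proof.
move=> p0; have := irr_factors_uniq p; rewrite uniq_pairwise.
apply: (@sub_in_pairwise _ (mem (irr_factors p))); last exact/allP.
by move=> f g; apply: irr_factors_coprime.
Qed.

(** * Inclusion-exclusion over the divisors of X^n - 1 *)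

Section Counting.

Variables (F : finFieldType) (L : fieldExtType F).

Local Notation n := (\dim {:L}).
Local Notation "p ^L" := (map_poly (in_alg L) p)
  (at level 2, left associativity, format "p ^L").
Local Notation cyc R := ('X^n - 1 : {poly R}).
Local Notation g_poly := (@g_poly F L).
Local Notation Q := (#|F|%:R : rat).

Let n_gt0 : (0 < n)%N.
Proof. exact: (adim_gt0 {:L}%AS). Qed.

Let cyc_neq0 (R : nzRingType) : cyc R != 0.
Proof. by rewrite -size_poly_eq0 size_XnsubC. Qed.

Let dvd_cyc_neq0 (h : {poly F}) : h %| cyc F -> h != 0.
Proof. by apply: contraTneq => ->; rewrite dvd0p cyc_neq0. Qed.

Let Q_neq0 : Q != 0.
Proof. by rewrite pnatr_eq0 -lt0n ltnW ?finNzRing_gt1. Qed.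

(** Inclusion-exclusion by induction on [S], for all [h] at once: from the count for the tail of [S]
    one subtracts the elements for which [h * f] also divides, and these form the same problem with
    [h * f] in place of [h]. *)
Lemma card_dvd_g_poly_avoiding (S : seq {poly F}) (h : {poly F}) :
    pairwise (@coprimep F) S -> h %| cyc F -> all (fun f => h * f %| cyc F) S ->
  #|[set x : finvect_type L | (h^L %| g_poly x) &&
       all (fun f => ~~ ((h * f)^L %| g_poly x)) S]|%:R
  = Q ^+ (n.+1 - size h) * \prod_(f <- S) (1 - Q ^- (size f).-1).
Proof.
elim: S h => [|f S IHS] h /=.
  move=> _ h_dvd _; rewrite big_nil mulr1 -natrX -(card_dvd_g_poly h_dvd).
  by congr _%:R; apply: eq_card => x; rewrite !inE andbT.
move=> /andP[cofS coS] h_dvd /andP[hf_dvd hS_dvd].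
have h0 := dvd_cyc_neq0 h_dvd; have hf0 := dvd_cyc_neq0 hf_dvd.
have f0 : f != 0 by apply: contraNneq hf0 => ->; rewrite mulr0.
have hfS_dvd : all (fun e => h * f * e %| cyc F) S.
  apply/allP => e eS; rewrite dvdp_mul_coprime ?hf_dvd ?(allP hS_dvd) //.
  exact: (allP cofS).
pose A := [set x : finvect_type L | (h^L %| g_poly x) &&
  all (fun e => ~~ ((h * e)^L %| g_poly x)) S].
pose B := [set x : finvect_type L | (h * f)^L %| g_poly x].
(* Once [h * f] divides g_x, coprimality of [e] and [f] makes divisibility by [h * e] equivalent to
   divisibility by [h * f * e]. *)
have cardAIB : #|A :&: B|%:R = Q ^+ (n.+1 - size (h * f)) * \prod_(e <- S) (1 - Q ^- (size e).-1).
  rewrite -IHS //; congr _%:R; apply: eq_card => x; rewrite !inE.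
  have [hf_dvdx|] := boolP ((h * f)^L %| g_poly x); last by rewrite andbF.
  rewrite (dvdp_trans _ hf_dvdx) ?dvdp_map ?dvdp_mulr // andbT /=.
  apply: eq_in_all => e eS; move: hf_dvdx; rewrite !rmorphM /= => hf_dvdx.
  rewrite dvdp_mul_coprime ?map_poly_eq0 ?hf_dvdx //.
  by rewrite coprimep_map (allP cofS).
have -> : [set x : finvect_type L | (h^L %| g_poly x) && (~~ ((h * f)^L %| g_poly x) &&
    all (fun e => ~~ ((h * e)^L %| g_poly x)) S)] = A :\: B.
  by apply/setP => x; rewrite !inE andbCA.
have := congr1 (fun k => k%:R : rat) (cardsID B A).
rewrite natrD cardAIB IHS // => /(canRL (addKr _)) ->.
(* The natural subtractions do not truncate, because [h * f] divides X^n - 1. *)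
have -> : Q ^+ (n.+1 - size h) = Q ^+ (n.+1 - size (h * f)) * Q ^+ (size f).-1.
  rewrite -exprD; congr (_ ^+ _); have := dvdp_leq (cyc_neq0 F) hf_dvd.
  rewrite size_XnsubC // size_mul //; move: (size_poly_gt0 h) (size_poly_gt0 f).
  by rewrite h0 f0; move: n (size h) (size f) => N a b; lia.
rewrite big_cons; field; exact: expf_neq0.
Qed.

(** If the gcd is [h], a divisor [h * f] of g_x and X^n - 1 would have too large a degree.
    Conversely the gcd is some [h * e] over [F], and a nonconstant [e] would have an irreducible
    factor [f] with [h * f] dividing g_x. *)
Lemma gcdp_g_poly_eqp (h : {poly F}) x : h %| cyc F ->
  (gcdp (cyc L) (g_poly x) %= h^L) =
  (h^L %| g_poly x) && all (fun f => ~~ ((h * f)^L %| g_poly x))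
                         [seq f <- irr_factors (cyc F) | h * f %| cyc F].
Proof.
move=> h_dvd; have h0 := dvd_cyc_neq0 h_dvd.
apply/idP/andP => [gcd_h|[hx /allP avoid]].
  split; first by rewrite -(eqp_dvdl _ gcd_h) dvdp_gcdr.
  apply/allP => f; rewrite mem_filter => /andP[hf_dvd /(mem_irr_factors _ (cyc_neq0 F))[mf [sz_f _] _]].
  apply/negP => hfx; have: (h * f)^L %| h^L.
    by rewrite -(eqp_dvdr _ gcd_h) dvdp_gcd hfx -(map_Xn_sub_1 (in_alg L)) dvdp_map hf_dvd.
  rewrite dvdp_map => /(dvdp_leq h0); rewrite size_Mmonic //.
  by have := size_poly_gt0 h; rewrite h0; move: sz_f; lia.
have [d [md d_dvd] gcd_d] := gcdp_g_poly_rational x.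
have: h %| d.
  by rewrite -(dvdp_map (in_alg L)) -(eqp_dvdr _ gcd_d) dvdp_gcd hx -(map_Xn_sub_1 (in_alg L)) dvdp_map h_dvd.
case/dvdpP=> e; rewrite mulrC => Dd; have := monic_neq0 md; rewrite Dd mulf_eq0 (negPf h0) /= => e0.
have [sz_e|/monic_irreducible_factor[f [mf irf f_dvd]]] := leqP (size e) 1.
  rewrite (eqp_trans gcd_d) // eqp_map Dd -[X in _ %= X]mulr1 eqp_mul2l //.
  by rewrite -size_poly_eq1 eqn_leq sz_e size_poly_gt0.
have hf_dvd : h * f %| d by rewrite Dd dvdp_mul2l.
have/avoid/negP[] : f \in [seq f <- irr_factors (cyc F) | h * f %| cyc F].
  rewrite mem_filter (dvdp_trans hf_dvd) //; apply/(mem_irr_factors _ (cyc_neq0 F)); split=> //.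
  by apply: dvdp_trans (dvdp_trans hf_dvd d_dvd); rewrite dvdp_mull.
apply: dvdp_trans (dvdp_gcdr (cyc L) _); rewrite (eqp_dvdr _ gcd_d).
by rewrite dvdp_map.
Qed.

Lemma num_k_normalE k : (num_k_normal L k)%:R =
  \sum_(h : {poly_k.+1 F} | [&& (h : {poly F}) \is monic, size (h : {poly F}) == k.+1 & (h : {poly F}) %| cyc F])
    Q ^+ n / Q ^+ k * \prod_(f <- irr_factors (cyc F) | (h : {poly F}) * f %| cyc F) (1 - Q ^- (size f).-1).
Proof.
pose H := [set h : {poly_k.+1 F} | [&& (h : {poly F}) \is monic, size (h : {poly F}) == k.+1 & (h : {poly F}) %| cyc F]].
pose G (h : {poly_k.+1 F}) := [set x : finvect_type L | gcdp (cyc L) (g_poly x) %= (h : {poly F})^L].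
have -> : num_k_normal L k = (\sum_(h in H) #|G h|)%N.
  rewrite /num_k_normal -sum1_card.
  (* Double counting: each k-normal element belongs to exactly one class [G h], since its gcd is
     associate to a unique monic polynomial over [F]. *)
  transitivity (\sum_(h in H) \sum_(x : finvect_type L | x \in G h) 1)%N; last first.
    by apply: eq_bigr => h _; rewrite sum1_card.
  rewrite (exchange_big_dep (fun x : finvect_type L => k_normal k (x : L))) /=; last first.
    move=> h x; rewrite !inE => /and3P[_ /eqP sz_h _] /eqp_size.
    by rewrite size_map_poly sz_h /k_normal => ->.
  apply: eq_big => x; rewrite inE // => kx.
  have [h [mh h_dvd] gcd_h] := gcdp_g_poly_rational x.
  have sz_h : size h = k.+1 by rewrite -(size_map_poly (in_alg L)) -(eqp_size gcd_h); apply/eqP.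
  rewrite (big_pred1 (NPoly (eq_leq sz_h : h \is a poly_of_size k.+1))) // => e.
  rewrite !inE -val_eqE /=; apply/andP/eqP => [[/and3P[me _ _] gcd_e]|->].
    apply/eqP; rewrite -eqp_monic // -(eqp_map (in_alg L)).
    by rewrite (eqp_trans _ gcd_h) // eqp_sym.
  by rewrite mh sz_h h_dvd eqxx.
rewrite natr_sum; apply: eq_big => h; rewrite inE // => /and3P[_ /eqP sz_h h_dvd].
have le_kn : (k <= n)%N.
  by have := dvdp_leq (cyc_neq0 F) h_dvd; rewrite sz_h size_XnsubC.
rewrite -big_filter -expfB_cond; last by rewrite (negPf Q_neq0).
rewrite (_ : (n - k)%N = (n.+1 - size (h : {poly F}))%N); last by rewrite sz_h.
rewrite -card_dvd_g_poly_avoiding //.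
- by congr _%:R; apply: eq_card => x; rewrite !inE gcdp_g_poly_eqp.
- exact: subseq_pairwise (filter_subseq _ _) (irr_factors_pairwise_coprime (cyc_neq0 F)).
by apply/allP => f; rewrite mem_filter => /andP[].
Qed.

End Counting.

(** * Degrees of the irreducible factors of X^m - 1 *)

Lemma iter_frob_act (F : finFieldType) (L : fieldExtType F) (j : nat) (x : L) :
  frob_act L ('X^j - 1) x = iter j (@frob F L) x - x.
Proof.
have frobX i : frob_act L 'X^i x = iter i (@frob F L) x.
  elim: i => [|i IHi]; first by rewrite expr0 /frob_act rmorph1 id_lfunE.
  by rewrite exprS frob_actM IHi /frob_act horner_algX lfunE.
by rewrite /frob_act rmorphB /= add_lfunE opp_lfunE -/(frob_act _ _) frobX rmorph1 id_lfunE.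
Qed.

(** Adjoin a root [z] of [f] to get a field of degree r = deg f. From z^m = 1 the d-th iterate of
    Frobenius fixes [z], hence the whole field, and so does the r-th; therefore the iterate of order
    d mod r is the identity as well. *)
Lemma irreducible_dvd_Xn_sub_1 (F : finFieldType) (f : {poly F}) (m d : nat) :
  irreducible_poly f -> f %| 'X^m - 1 -> (#|F| ^ d = 1 %[mod m])%N ->
  ((size f).-1 %| d)%N.
Proof.
move=> irf f_dvd qd1; have [L dimL [z fz0 genL]] := irredp_FAdjoin irf.
have zm1 : z ^+ m = 1.
  have /dvdpP[e De] := f_dvd; have: root ('X^m - 1) z.
    by rewrite -(map_Xn_sub_1 (in_alg L)) De rmorphM rootM fz0 orbT.
  by rewrite /root !hornerE subr_eq0 => /eqP.
have q_gt0 : (0 < #|F| ^ d)%N by rewrite expn_gt0 ltnW // finNzRing_gt1.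
have zq : iter d (@frob F L) z = z.
  move/eqP: qd1; rewrite eqn_mod_dvd // => /dvdnP[k Dk].
  by rewrite iter_frob -(subnK q_gt0) Dk addn1 exprSr mulnC exprM zm1 expr1n mul1r.
have iterM i (a : {poly F}) : iter i (@frob F L) (map_poly (in_alg L) a).[z] = (map_poly (in_alg L) a).[iter i (@frob F L) z].
  elim: i => //= i ->; rewrite -horner_map -map_poly_comp; congr _.[_].
  by apply: eq_map_poly => b /=; rewrite linearZ /= rmorph1.
have frob_d x : iter d (@frob F L) x = x.
  have: x \in <<1; z>>%VS by rewrite genL memvf.
  by case/Fadjoin_polyP => _ /polyOver1P[a ->] ->; rewrite iterM zq.
set r := (size f).-1 in dimL *.
have frob_r x : iter r (@frob F L) x = x by rewrite -dimL iter_frob_dim.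
have frob_mod x : iter (d %% r) (@frob F L) x = x.
  have frob_mul k y : iter (k * r) (@frob F L) y = y.
    by elim: k => //= k IHk; rewrite mulSn iterD IHk frob_r.
  by rewrite -{2}[x]frob_d {2}(divn_eq d r) addnC iterD frob_mul.
have r_gt0 : (0 < r)%N by case: irf => sz_f _; rewrite -ltnS /r prednK // ltnW.
rewrite /dvdn; apply: contraLR (ltn_pmod d r_gt0); rewrite -lt0n -leqNgt => j_gt0.
(* With j = d mod r positive, X^j - 1 kills the whole field, so the kernel bound gives r <= j,
   contradicting j < r. *)
have := @dim_lker_frob_act_leq F L ('X^(d %% r) - 1).
rewrite size_XnsubC // -size_poly_eq0 size_XnsubC // => /(_ isT); apply: leq_trans.
rewrite -{1}dimL; apply: dimvS; apply/subvP => x _.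
by rewrite memv_ker iter_frob_act frob_mod subrr.
Qed.

(** * Factorisation of separable polynomials and of their powers *)

Lemma dvdp_prod_coprime (R : fieldType) (s : seq {poly R}) (p : {poly R}) :
  pairwise (@coprimep R) s -> all (fun f => f %| p) s -> \prod_(f <- s) f %| p.
Proof.
elim: s => [|f s IHs] /=; first by rewrite big_nil dvd1p.
move=> /andP[/allP cofs cos] /andP[fp sp]; rewrite big_cons Gauss_dvdp ?fp ?IHs //.
by rewrite big_seq; apply: (big_ind (coprimep f)) => // [|a b]; rewrite ?coprimep1 // coprimepMr => -> ->.
Qed.

(** The product divides [p] by coprimality. An irreducible factor of the cofactor would already
    occur in the product, so its square would divide the separable [p]. *)
Lemma prod_irr_factors_separable (F : finFieldType) (p : {poly F}) :
  p \is monic -> separable_poly p -> \prod_(f <- irr_factors p) f = p.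
Proof.
move=> mp sep_p; have p0 := monic_neq0 mp.
have : \prod_(f <- irr_factors p) f %| p.
  apply: dvdp_prod_coprime; first exact: irr_factors_pairwise_coprime.
  by apply/allP => f /(mem_irr_factors _ p0)[].
have mprod : \prod_(f <- irr_factors p) f \is monic.
  by rewrite big_seq; apply: monic_prod => f /(mem_irr_factors _ p0)[].
case/dvdpP => e Dp; have me : e \is monic by rewrite -(monicMr _ mprod) -Dp.
suff sz_e : (size e <= 1)%N.
  suff e1 : e = 1 by rewrite [RHS]Dp e1 mul1r.
  apply/eqP; rewrite -eqp_monic ?monic1 // -size_poly_eq1 eqn_leq sz_e.
  by rewrite size_poly_gt0 monic_neq0.
rewrite leqNgt; apply/negP => /monic_irreducible_factor[f [mf irf f_dvd]].
have f_sz : size f != 1%N by case: irf => /gtn_eqF ->.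
have fI : f \in irr_factors p.
  by apply/(mem_irr_factors _ p0); split=> //; rewrite Dp dvdp_mulr.
have := separable_nosquare sep_p (isT : (1 < 2)%N) f_sz; rewrite expr2 {1}Dp.
by rewrite dvdp_mul // (big_rem f) //= dvdp_mulr.
Qed.

Lemma sum_deg_irr_factors_separable (F : finFieldType) (p : {poly F}) :
  p \is monic -> separable_poly p ->
  (\sum_(f <- irr_factors p) (size f).-1 = (size p).-1)%N.
Proof.
move=> mp sep_p; rewrite -[in RHS](prod_irr_factors_separable mp sep_p).
have: all (fun f : {poly F} => f \is monic) (irr_factors p).
  by apply/allP => f /(mem_irr_factors _ (monic_neq0 mp))[].
elim: (irr_factors p) => [|f s IHs] /=; first by rewrite !big_nil size_poly1.
case/andP=> mf ms; rewrite !big_cons IHs //.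
have mprod : \prod_(e <- s) e \is monic.
  by rewrite big_seq; apply: monic_prod => e /(allP ms).
rewrite size_Mmonic ?monic_neq0 //.
have f_gt0 : (0 < size f)%N by rewrite size_poly_gt0 monic_neq0.
have prod_gt0 : (0 < size (\prod_(e <- s) e)%R)%N by rewrite size_poly_gt0 monic_neq0.
by rewrite -!subn1 addnBAC // addnBA // subnAC.
Qed.

Lemma num_irr_factorsE (F : finFieldType) (n r : nat) : (0 < n)%N ->
  num_irr_factors F n r = count (fun f : {poly F} => size f == r.+1) (irr_factors ('X^n - 1)).
Proof.
move=> n_gt0; have p0 : 'X^n - 1 != 0 :> {poly F} by rewrite -size_poly_eq0 size_XnsubC.
rewrite -size_filter /num_irr_factors cardE -(size_map val); apply/perm_size/uniq_perm.
- by rewrite map_inj_uniq ?enum_uniq //; apply: val_inj.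
- exact/filter_uniq/irr_factors_uniq.
move=> f; rewrite mem_filter; apply/mapP/andP => [[e]|[/eqP sz_f /(mem_irr_factors _ p0)[mf /irreducibleP irf f_dvd]]].
  rewrite mem_enum inE => /and4P[me /irreducibleP ire /eqP sz_e e_dvd] ->.
  by split; [apply/eqP|apply/mem_irr_factors].
exists (NPoly (eq_leq sz_f : f \is a poly_of_size r.+1)) => //.
by rewrite mem_enum inE /= mf irf sz_f f_dvd eqxx.
Qed.

Lemma prod_by_value (R : comNzRingType) (T : eqType) (J : eqType) (s : seq T) (D : seq J)
    (k : T -> J) (G : J -> R) : uniq D -> all (fun x => k x \in D) s ->
  \prod_(x <- s) G (k x) = \prod_(r <- D) G r ^+ count (fun x => k x == r) s.
Proof.
move=> uD; elim: s => [|x s IHs] /= => [_|/andP[kxD ksD]].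
  by rewrite big_nil big1.
rewrite big_cons IHs // (bigD1_seq (k x)) //= [in RHS](bigD1_seq (k x)) //= eqxx.
rewrite exprS mulrA; congr (_ * _); apply: eq_bigr => r ne_r.
by rewrite eq_sym (negPf ne_r).
Qed.

Lemma perm_irr_factors_exp (F : finFieldType) (p : {poly F}) (m : nat) :
  p != 0 -> (0 < m)%N -> perm_eq (irr_factors (p ^+ m)) (irr_factors p).
Proof.
move=> p0 m_gt0; apply: uniq_perm; rewrite ?irr_factors_uniq // => f.
apply/(mem_irr_factors _ (expf_neq0 m p0))/(mem_irr_factors _ p0) => -[mf irf f_dvd].
  split=> //; apply: contraTT f_dvd; rewrite -!irreducible_poly_coprime //.
  by rewrite coprimep_pexpr.
by split=> //; rewrite -(prednK m_gt0) exprS dvdp_mulr.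
Qed.

(** By separability p = u * f with [u] coprime to [f], so [f] has multiplicity exactly [m] in
    [p ^+ m]. *)
Lemma irr_factor_exp_dvd (F : finFieldType) (p f : {poly F}) (k m : nat) :
  p != 0 -> separable_poly p -> f \in irr_factors p -> (f ^+ k %| p ^+ m) = (k <= m)%N.
Proof.
move=> p0 sep_p /(mem_irr_factors _ p0)[_ [sz_f _] /dvdpP[u Dp]].
have cofu : coprimep f u by apply: (separable_coprime sep_p); rewrite Dp mulrC.
by rewrite Dp exprMn Gauss_dvdpr ?dvdp_Pexp2l // coprimep_expl // coprimep_expr.
Qed.

Lemma prod_notin (K : fieldType) (T : eqType) (s t : seq T) (c : T -> K) :
  uniq s -> uniq t -> {subset t <= s} -> (forall x, x \in t -> c x != 0) ->
  \prod_(x <- s | x \notin t) c x = \prod_(x <- s) c x / \prod_(x <- t) c x.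
Proof.
move=> us ut sub_ts c0; have -> : \prod_(x <- t) c x = \prod_(x <- s | x \in t) c x.
  rewrite -[RHS]big_filter; apply/perm_big/uniq_perm; rewrite ?filter_uniq // => x.
  by rewrite mem_filter; apply/idP/andP => [xt|[]] //; rewrite xt sub_ts.
rewrite [X in X / _](bigID (mem t)) /= mulrC mulKf // prodf_seq_neq0.
by apply/allP => x _; apply/implyP/c0.
Qed.

(** * Monic quadratic divisors of a power of a separable polynomial *)

Definition quadratic_divisor (F : finFieldType) (p : {poly F}) (h : {poly_3 F}) :=
  [&& (h : {poly F}) \is monic, size (h : {poly F}) == 3 & (h : {poly F}) %| p].

Section QuadraticDivisors.

Variables (F : finFieldType) (p : {poly F}) (m : nat).
Hypotheses (monic_p : p \is monic) (sep_p : separable_poly p) (m_gt0 : (0 < m)%N).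

(* Applied with [C k = 1 - q ^- k], the proportion of units modulo a monic
   irreducible polynomial of degree [k]. *)
Variables (K : fieldType) (C : nat -> K).
Hypothesis C_neq0 : forall k, (0 < k)%N -> C k != 0.

Local Notation I := (irr_factors (p ^+ m)).
Local Notation c f := (C (size f).-1).
Local Notation W := (\prod_(f <- I) c f).

(** For p^m = X^n - 1 and C k = 1 - q^-k, this is the product that multiplies q^(n - deg h) in the
    number of elements whose gcd is [h]. *)
Definition weight (h : {poly F}) : K := \prod_(f <- I | h * f %| p ^+ m) c f.

Let p_neq0 : p != 0 := monic_neq0 monic_p.
Let pm_neq0 : p ^+ m != 0 := expf_neq0 m p_neq0.

Let I_exp_dvd f k : f \in I -> (f ^+ k %| p ^+ m) = (k <= m)%N.
Proof.
rewrite (perm_mem (perm_irr_factors_exp p_neq0 m_gt0)).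
exact: irr_factor_exp_dvd.
Qed.

Let I_dvd f : f \in I -> f %| p ^+ m.
Proof. by case/(mem_irr_factors _ pm_neq0). Qed.

Let I_coprime e f : e \in I -> f \in I -> f != e -> coprimep e f.
Proof. by move=> eI fI ne; rewrite coprimep_sym; apply: (irr_factors_coprime pm_neq0). Qed.

(** The list [t] holds the irreducible factors whose multiplicity in [p ^+ m] is exhausted by [h];
    exactly their contributions are missing from the full product [W]. *)
Lemma weightE (h : {poly F}) (t : seq {poly F}) : uniq t -> {subset t <= I} ->
  {in I, forall f, (h * f %| p ^+ m) = (f \notin t)} ->
  weight h = W / \prod_(f <- t) c f.
Proof.
move=> ut tI ht; rewrite /weight -prod_notin ?irr_factors_uniq //.
  by rewrite [LHS]big_seq_cond [RHS]big_seq_cond; apply: eq_bigl => f; apply: andb_id2l => fI; apply: ht.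
move=> f /tI/(mem_irr_factors _ pm_neq0)[_ [sz_f _] _]; apply: C_neq0.
by rewrite -ltnS prednK // ltnW.
Qed.

(** Every irreducible factor has multiplicity [m], so [h] exhausts only itself, and only when m =
    1. *)
Lemma weight_irreducible h : h \in I -> weight h = W / (if (1 < m)%N then 1 else c h).
Proof.
move=> hI; rewrite (@weightE h (if (1 < m)%N then [::] else [:: h])).
- by case: ifP => _; rewrite ?big_nil ?big_seq1.
- by case: ifP.
- by case: ifP => _ f //; rewrite inE => /eqP->.
move=> f fI; have [->|ne_fh] := eqVneq f h.
  by rewrite -expr2 I_exp_dvd //; case: ifP => _; rewrite ?inE ?eqxx.
rewrite Gauss_dvdp ?I_coprime // !I_dvd //.
by case: ifP => _; rewrite ?inE ?ne_fh.
Qed.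

(** Only [e] can be exhausted, and this happens exactly when m = 2. *)
Lemma weight_square e : e \in I -> (1 < m)%N -> weight (e ^+ 2) = W / (if (2 < m)%N then 1 else c e).
Proof.
move=> eI m_gt1; rewrite (@weightE _ (if (2 < m)%N then [::] else [:: e])).
- by case: ifP => _; rewrite ?big_nil ?big_seq1.
- by case: ifP.
- by case: ifP => _ f //; rewrite inE => /eqP->.
move=> f fI; have [->|ne_fe] := eqVneq f e.
  by rewrite -exprSr I_exp_dvd //; case: ifP => _; rewrite ?inE ?eqxx.
rewrite Gauss_dvdp ?coprimep_expl ?I_coprime // I_exp_dvd // m_gt1 I_dvd //.
by case: ifP => _; rewrite ?inE ?ne_fe.
Qed.

(** Both linear or higher factors [e1] and [e2] are exhausted when m = 1, and neither is
    otherwise. *)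
Lemma weight_pair e1 e2 : e1 \in I -> e2 \in I -> e1 != e2 ->
  weight (e1 * e2) = W / (if (1 < m)%N then 1 else c e1 * c e2).
Proof.
move=> e1I e2I ne12; rewrite (@weightE _ (if (1 < m)%N then [::] else [:: e1; e2])).
- by case: ifP => _; rewrite ?big_nil // big_cons big_seq1.
- by case: ifP => _ //=; rewrite inE ne12.
- by case: ifP => _ f //; rewrite !inE => /orP[]/eqP->.
have square_dvd e e' : e \in I -> e' \in I -> e' != e -> (e * e' * e %| p ^+ m) = (1 < m)%N.
  move=> eI e'I ne; rewrite mulrAC -expr2 Gauss_dvdp ?coprimep_expl ?I_coprime //.
  by rewrite I_exp_dvd // I_dvd // andbT.
move=> f fI; have [->|ne1] := eqVneq f e1.
  by rewrite square_dvd // 1?eq_sym //; case: ifP => _; rewrite ?inE ?eqxx.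
have [->|ne2] := eqVneq f e2.
  by rewrite [e1 * e2]mulrC square_dvd //; case: ifP => _; rewrite ?inE ?eqxx ?orbT.
rewrite Gauss_dvdp; last by rewrite coprimepMl !I_coprime.
rewrite Gauss_dvdp; last by rewrite I_coprime // eq_sym.
by rewrite !I_dvd //; case: ifP => _; rewrite ?inE ?(negPf ne1) ?(negPf ne2).
Qed.

Local Notation R := [set a : F | root p a].

Let XsubC_I a : ('X - a%:P \in I) = (a \in R).
Proof.
rewrite (perm_mem (perm_irr_factors_exp p_neq0 m_gt0)) inE -dvdp_XsubCl.
by apply/(mem_irr_factors _ p_neq0)/idP => [[]|] //; split; rewrite ?monicXsubC //; apply: irredp_XsubC.
Qed.

Let polyXsubC_inj : injective (fun a : F => 'X - a%:P).
Proof. by move=> a b /(congr1 (root^~ a)); rewrite !root_XsubC eqxx => /esym/eqP. Qed.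

Lemma size2_monic (e : {poly F}) : e \is monic -> size e = 2%N -> exists a, e = 'X - a%:P.
Proof.
move=> me sz_e; exists (- e`_0); apply/polyP => -[|[|i]]; rewrite coefB coefX coefC /=.
- by rewrite sub0r opprK.
- by move: me; rewrite monicE lead_coefE sz_e subr0 => /eqP.
by rewrite subr0 nth_default // sz_e.
Qed.

(** Replaces v_1 by a number of roots, so that split quadratics can be counted through elements and
    pairs of elements of [F]. *)
Lemma card_linear_factors :
  count (fun f : {poly F} => size f == 2%N) I = #|R|.
Proof.
rewrite -size_filter cardE -(size_map (fun a : F => 'X - a%:P)).
apply/perm_size/uniq_perm; first exact/filter_uniq/irr_factors_uniq.
  by rewrite map_inj_uniq ?enum_uniq.
move=> f; rewrite mem_filter; apply/andP/mapP => [[/eqP sz_f fI]|[a]].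
  have [mf _ _] := mem_irr_factors _ pm_neq0 fI.
  by have [a Df] := size2_monic mf sz_f; exists a; rewrite // mem_enum -XsubC_I -Df.
by rewrite mem_enum -XsubC_I => aI ->; rewrite size_XsubC.
Qed.

Local Notation H h := (quadratic_divisor (p ^+ m) h).
Local Notation irr h := (irreducibleb (polyn h)).
Local Notation sq h := [exists a : F, polyn h == ('X - a%:P) ^+ 2].

Let size_XsubC_mul (a b : F) : size (('X - a%:P) * ('X - b%:P)) = 3.
Proof. by rewrite size_Mmonic ?monicXsubC ?polyXsubC_eq0 // !size_XsubC. Qed.

Let mul_XsubC_reducible (h : {poly_3 F}) (a b : F) :
  h = ('X - a%:P) * ('X - b%:P) :> {poly F} -> ~~ irr h.
Proof.
move=> Dh; apply/irreducibleP => -[_ /(_ ('X - a%:P))].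
rewrite size_XsubC Dh dvdp_mulr // => /(_ isT isT)/eqp_size.
by rewrite size_XsubC size_XsubC_mul.
Qed.

Let root_in_R (h : {poly_3 F}) a : H h -> 'X - a%:P %| (h : {poly F}) -> a \in R.
Proof.
case/and3P=> _ _ h_dvd a_dvd; rewrite -XsubC_I; apply/(mem_irr_factors _ pm_neq0).
by split; [rewrite monicXsubC|exact: irredp_XsubC|exact: dvdp_trans a_dvd h_dvd].
Qed.

Let reducible_mul_XsubC h : H h -> ~~ irr h ->
  exists a b, [/\ a \in R, b \in R & h = ('X - a%:P) * ('X - b%:P) :> {poly F}].
Proof.
move=> Hh red_h; have [mh /eqP sz_h _] := and3P Hh.
have /existsP[a ha0] : [exists a, root (h : {poly F}) a].
  apply: contraR red_h; rewrite negb_exists => /forallP no_root.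
  by apply/irreducibleP/cubic_irreducible; rewrite ?sz_h.
have /factor_theorem[e De] := ha0.
have me : e \is monic by rewrite -(monicMr e (monicXsubC a)) -De.
have sz_e : size e = 2%N.
  have := sz_h; rewrite De size_Mmonic ?monic_neq0 ?monicXsubC //.
  by rewrite size_XsubC addn2 => -[].
have [b Db] := size2_monic me sz_e; rewrite mulrC Db in De.
exists a, b; rewrite De; split=> //; apply: (root_in_R Hh); rewrite De.
  by rewrite dvdp_mulr.
by rewrite dvdp_mull.
Qed.

(** For m > 1 the squares correspond to the roots of [p]; for m = 1 no square of a linear factor
    divides a separable polynomial. *)
Let card_quadratic_squares :
  #|[set h | (H h && ~~ irr h) && sq h]| = (if (1 < m)%N then #|R| else 0)%N.
Proof.
case: ifP => [m_gt1|m_le1]; last first.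
  apply/eqP; rewrite cards_eq0; apply/eqP/setP => h; rewrite !inE.
  apply/negP => /andP[/andP[Hh red_h] /existsP[a /eqP Dh]].
  have aI : 'X - a%:P \in I by rewrite XsubC_I (root_in_R Hh) // Dh dvdp_mulr.
  by have [_ _] := and3P Hh; rewrite Dh I_exp_dvd // m_le1.
pose s (a : F) : {poly_3 F} := npolyp 3 (('X - a%:P) ^+ 2).
have sE a : s a = ('X - a%:P) ^+ 2 :> {poly F} by rewrite npolypK // size_XsubC_mul.
rewrite -(@card_imset _ _ s); last first.
  move=> a b /(congr1 (fun h : {poly_3 F} => root (h : {poly F}) a)).
  by rewrite !sE !rootM !root_XsubC !orbb eqxx => /esym/eqP.
apply: eq_card => h; rewrite inE; apply/idP/imsetP => [/andP[/andP[Hh red_h] /existsP[a /eqP Dh]]|[a aR ->]].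
  exists a; last by apply/val_inj; rewrite /= sE.
  by rewrite (root_in_R Hh) // Dh dvdp_mulr.
rewrite (mul_XsubC_reducible (sE a)) andbT; apply/andP; split.
  rewrite /quadratic_divisor sE monic_exp ?monicXsubC // size_XsubC_mul.
  by rewrite I_exp_dvd ?XsubC_I.
by apply/existsP; exists a; rewrite sE.
Qed.

(** A product of two distinct linear factors corresponds to the two-element set of its roots, from
    which it is recovered. *)
Let card_quadratic_pairs :
  #|[set h | (H h && ~~ irr h) && ~~ sq h]| = 'C(#|R|, 2).
Proof.
pose s (A : {set F}) : {poly_3 F} := npolyp 3 (\prod_(a in A) ('X - a%:P)).
pose D := [set A : {set F} | A \subset R & #|A| == 2%N].
have s2E a b : a != b -> s [set a; b] = ('X - a%:P) * ('X - b%:P) :> {poly F}.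
  by move=> ne; rewrite npolypK big_setU1 ?inE //= big_set1 // size_XsubC_mul.
rewrite -cards_draws -/D -(@card_in_imset _ _ s); last first.
  move=> A B; rewrite !inE => /andP[_ /cards2P[a [b [neab ->]]]] /andP[_ /cards2P[c [d [necd ->]]]].
  move/(congr1 (fun h : {poly_3 F} => root (h : {poly F}))); rewrite !s2E // => eq_root.
  apply/setP => x; have := congr1 (@^~ x) eq_root.
  by rewrite /= !rootM !root_XsubC !inE.
apply: eq_card => h; rewrite inE; apply/idP/imsetP => [/andP[/andP[Hh red_h] nsq_h]|[A]].
  have [a [b [aR bR Dh]]] := reducible_mul_XsubC Hh red_h.
  have neab : a != b.
    by apply: contraNneq nsq_h => eqab; apply/existsP; exists a; rewrite Dh -eqab expr2.
  exists [set a; b]; last by apply/val_inj; rewrite /= s2E.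
  by rewrite inE cards2 neab andbT; apply/subsetP => x; rewrite !inE => /orP[]/eqP->; have := aR; have := bR; rewrite !inE.
rewrite inE => /andP[/subsetP sAR /cards2P[a [b [neab DA]]]] ->.
have [aR bR] : a \in R /\ b \in R by split; apply: sAR; rewrite DA !inE eqxx ?orbT.
have Ds := s2E a b neab; rewrite {A}DA in sAR *.
have neXab : 'X - b%:P != 'X - a%:P by rewrite (inj_eq polyXsubC_inj) eq_sym.
apply/andP; split; [apply/andP; split|].
- rewrite /quadratic_divisor Ds monicMl ?monicXsubC // size_XsubC_mul Gauss_dvdp ?I_coprime ?XsubC_I //.
  by rewrite !I_dvd ?XsubC_I.
- exact: mul_XsubC_reducible Ds.
apply/existsP => -[c /eqP]; rewrite Ds => Dc.
have := congr1 (root^~ a) Dc; have := congr1 (root^~ b) Dc.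
rewrite !rootM !root_XsubC !eqxx !orbb ?orbT => /esym/eqP eqb /esym/eqP eqa.
by rewrite eqa eqb eqxx in neab.
Qed.

Let sum_const (T : finType) (P : pred T) (G : T -> K) (k : K) :
  (forall x, P x -> G x = k) -> \sum_(x | P x) G x = #|[set x | P x]|%:R * k.
Proof.
move=> Gk; rewrite (eq_bigr (fun=> k)) // mulr_natl -sumr_const.
by apply: eq_bigl => x; rewrite inE.
Qed.

Lemma sum_weight_quadratic :
  \sum_(h | H h) weight h =
    #|[set h | H h && irr h]|%:R * (W / (if (1 < m)%N then 1 else C 2))
  + (if (1 < m)%N then #|R| else 0)%N%:R * (W / (if (2 < m)%N then 1 else C 1))
  + 'C(#|R|, 2)%:R * (W / (if (1 < m)%N then 1 else C 1 ^+ 2)).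
Proof.
rewrite (bigID (fun h => irr h)) /= [X in _ + X](bigID (fun h => sq h)) /= addrA; congr (_ + _ + _).
- apply: sum_const => h /andP[/and3P[mh /eqP sz_h h_dvd] /irreducibleP irr_h].
  rewrite weight_irreducible ?sz_h //.
  by apply/(mem_irr_factors _ pm_neq0).
- rewrite -card_quadratic_squares.
  have [m_gt1|m_le1] := boolP (1 < m)%N.
    apply: sum_const => h /andP[/andP[Hh red_h] /existsP[a /eqP Dh]].
    rewrite Dh weight_square ?size_XsubC // XsubC_I.
    by rewrite (root_in_R Hh) // Dh dvdp_mulr.
  (* For m = 1 the sum over squares is empty, in agreement with the zero coefficient. *)
  have := card_quadratic_squares; rewrite (negPf m_le1) => /eqP; rewrite cards_eq0 => /eqP S0.
  rewrite S0 cards0 mul0r big_pred0 // => h.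
  by have := in_set0 h; rewrite -S0 inE.
rewrite -card_quadratic_pairs; apply: sum_const => h /andP[/andP[Hh red_h] nsq_h].
have [a [b [aR bR Dh]]] := reducible_mul_XsubC Hh red_h.
rewrite Dh weight_pair ?XsubC_I // ?size_XsubC ?expr2 //.
rewrite (inj_eq polyXsubC_inj); apply: contraNneq nsq_h => eqab.
by apply/existsP; exists a; rewrite Dh -eqab expr2.
Qed.

End QuadraticDivisors.

(** * Evaluation at X^n - 1 and the three cases of the formula *)

Lemma natr_bin2 (R : numFieldType) (k : nat) : 'C(k, 2)%:R = 2^-1 * k%:R * (k%:R - 1) :> R.
Proof.
elim: k => [|k IHk]; first by rewrite mulr0 mul0r.
by rewrite binS bin1 natrD IHk -[in RHS]addn1 natrD; field.
Qed.

Lemma Xn_sub_1_expp (R : comNzRingType) (p s k : nat) : p \in [pchar R] ->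
  ('X^(p ^ s * k) - 1 : {poly R}) = ('X^k - 1) ^+ (p ^ s).
Proof.
move=> pR; have pRX : p \in [pchar {poly R}] by rewrite pchar_poly.
have -> : ('X^k - 1) ^+ (p ^ s) = iter s (pFrobenius_aut pRX) ('X^k - 1).
  by elim: s => [|s IHs]; rewrite ?expn0 ?expr1 // iterS -IHs pFrobenius_autE -exprM -expnSr.
elim: s => [|s IHs]; first by rewrite expn0 mul1n.
rewrite iterS -IHs rmorphB rmorph1 /= pFrobenius_autE -exprM expnSr.
by rewrite mulnAC.
Qed.

(** A factor of degree k contributes q^-k * (q^k - 1). The degrees add up to n by separability,
    which gives q^-n; the rest is grouped by degree, every degree being a divisor of [d]. *)
Lemma prod_irr_factors_Xn_sub_1 (F : finFieldType) (n d : nat) :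
  n%:R != 0 :> F -> (#|F| ^ d = 1 %[mod n])%N -> (0 < d)%N ->
  \prod_(f <- irr_factors ('X^n - 1 : {poly F})) (1 - (#|F|%:R : rat) ^- (size f).-1) =
  (#|F|%:R : rat) ^- n *
  \prod_(r <- divisors d) ((#|F|%:R : rat) ^+ r - 1) ^+ num_irr_factors F n r.
Proof.
move=> nF qd1 d_gt0; set Q : rat := #|F|%:R.
have n_gt0 : (0 < n)%N by rewrite lt0n; apply: contraNneq nF => ->.
have mp : ('X^n - 1 : {poly F}) \is monic by exact: monicXnsubC.
have sep_p := separable_Xn_sub_1 nF.
have Q0 : Q != 0 by rewrite pnatr_eq0 -lt0n ltnW ?finNzRing_gt1.
have -> : Q ^- n = \prod_(f <- irr_factors ('X^n - 1 : {poly F})) Q ^- (size f).-1.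
  by rewrite prodfV prodrXr sum_deg_irr_factors_separable // size_XnsubC.
have degs : all (fun f : {poly F} => (size f).-1 \in divisors d) (irr_factors ('X^n - 1)).
  apply/allP => f /(mem_irr_factors _ (monic_neq0 mp))[_ irf f_dvd].
  by rewrite -dvdn_divisors //; apply: irreducible_dvd_Xn_sub_1 qd1.
have -> : \prod_(r <- divisors d) (Q ^+ r - 1) ^+ num_irr_factors F n r =
    \prod_(f <- irr_factors ('X^n - 1 : {poly F})) (Q ^+ (size f).-1 - 1).
  rewrite (prod_by_value (fun r => Q ^+ r - 1) (divisors_uniq d) degs).
  rewrite [LHS]big_seq [RHS]big_seq; apply: eq_bigr => r r_dvd; congr (_ ^+ _).
  rewrite num_irr_factorsE //; apply: eq_count => f /=.
  have r_gt0 : (0 < r)%N by rewrite (@dvdn_gt0 r d) ?dvdn_divisors.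
  (* Positivity of [r] rules out the default value [0.-1 = 0]. *)
  by case: (size f) => [|k] /=; rewrite ?eqSS ?(ltn_eqF r_gt0).
rewrite -big_split; apply: eq_bigr => f _ /=.
by rewrite mulrBr mulVf ?mulr1 // expf_neq0.
Qed.

Theorem proposition4p2
  (F : finFieldType) (L : fieldExtType F) (q p n s n0 d : nat)
  (hq : #|F| = q) (hp : p \in [pchar F])
  (hn : \dim {:L} = n) (n_gt0 : (0 < n)%N)
  (n_eq : n = (p ^ s * n0)%N) (n0_coprime : coprime n0 p)
  (d_gt0 : (0 < d)%N) (hd : (q ^ d = 1 %[mod n0])%N)
  (d_min : forall m : nat, (0 < m)%N -> (q ^ m = 1 %[mod n0])%N -> (d <= m)%N) :
  let v (r : nat) : rat := (num_irr_factors F n r)%:R in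
  let Q : rat := q%:R in
  let N2 : rat := (num_k_normal L 2)%:R in
  let P : rat := \prod_(r <- divisors d) (Q ^+ r - 1) ^+ num_irr_factors F n r in
  [/\ n <> n0 -> (p ^ s > 2)%N ->
        N2 = (v 1%N + 2^-1 * v 1%N * (v 1%N - 1) + v 2%N)
             * Q ^ (n%:Z - n0%:Z - 2) * P,
      n <> n0 -> (p ^ s = 2)%N ->
        N2 = (Q / (Q - 1) * v 1%N + 2^-1 * v 1%N * (v 1%N - 1) + v 2%N)
             * Q ^ (n%:Z - n0%:Z - 2) * P
    & n = n0 ->
        N2 = (v 1%N * (v 1%N - 1) / (2 * (Q - 1) ^+ 2) + v 2%N / (Q ^+ 2 - 1)) * P].
Proof.
move=> v Q N2 P.
have p_pr : prime p := pcharf_prime hp.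
have m_gt0 : (0 < p ^ s)%N by rewrite expn_gt0 prime_gt0.
have n0_gt0 : (0 < n0)%N by move: n_gt0; rewrite n_eq muln_gt0 => /andP[].
have n0F : n0%:R != 0 :> F by rewrite -(dvdn_pcharf hp) -prime_coprime // coprime_sym.
have Q_gt1 : 1 < Q by rewrite ltr1n -hq finNzRing_gt1.
have Q0 : Q != 0 by rewrite gt_eqF // (lt_trans ltr01).
have QX1 k : (0 < k)%N -> Q ^+ k - 1 != 0.
  by move=> k_gt0; rewrite subr_eq0 gt_eqF // exprn_egt1 // -lt0n.
have cycE : 'X^n - 1 = ('X^n0 - 1) ^+ (p ^ s) :> {poly F}.
  by rewrite n_eq Xn_sub_1_expp.
have mono : ('X^n0 - 1 : {poly F}) \is monic by exact: monicXnsubC.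
have sep := separable_Xn_sub_1 n0F.
pose C k : rat := 1 - Q ^- k.
have C0 k : (0 < k)%N -> C k != 0.
  move=> /QX1; apply: contraNneq => /(congr1 ( *%R (Q ^+ k))).
  by rewrite mulr0 mulrBr mulr1 mulfV ?expf_neq0 // => ->.
pose W := \prod_(f <- irr_factors ('X^n - 1 : {poly F})) C (size f).-1.
have num_irr r : num_irr_factors F n r = num_irr_factors F n0 r.
  rewrite !num_irr_factorsE // cycE.
  by apply/permP/perm_irr_factors_exp; rewrite ?monic_neq0.
have W_E : W = Q ^- n0 * P.
  rewrite /W cycE (perm_big _ (perm_irr_factors_exp (monic_neq0 mono) m_gt0)) /C /Q -hq.
  rewrite (@prod_irr_factors_Xn_sub_1 F n0 d) ?hq //; congr (_ * _).
  by apply: eq_bigr => r _; rewrite num_irr.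
(* The three terms come from irreducible quadratics, squares of linear factors, and products of two
   distinct linear factors. *)
have N2E : N2 = Q ^+ n / Q ^+ 2 *
    (v 2%N * (W / (if (1 < p ^ s)%N then 1 else C 2)) +
     (if (1 < p ^ s)%N then v 1%N else 0) * (W / (if (2 < p ^ s)%N then 1 else C 1)) +
     2^-1 * v 1%N * (v 1%N - 1) * (W / (if (1 < p ^ s)%N then 1 else C 1 ^+ 2))).
  rewrite /N2 num_k_normalE hn -mulr_sumr hq; congr (_ * _).
  transitivity (\sum_(h | quadratic_divisor (('X^n0 - 1) ^+ (p ^ s)) h)
      weight ('X^n0 - 1) (p ^ s) C (h : {poly F})).
    by rewrite /weight -cycE.
  rewrite (sum_weight_quadratic mono sep m_gt0 C0) -(card_linear_factors mono m_gt0).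
  rewrite -cycE -num_irr_factorsE // natr_bin2 -/(v 1%N) -/W; congr (_ * _ + _ * _ + _).
    congr _%:R; apply: eq_card => h; rewrite !inE /quadratic_divisor.
    by rewrite -!andbA; do !bool_congr.
  by case: ifP.
have expE : Q ^ (n%:Z - n0%:Z - 2) = Q ^+ n / Q ^+ n0 / Q ^+ 2.
  by rewrite -[X in _ - X]/(2%:Z) !expfzDr // -!exprnN.
have sub1 : Q - 1 != 0 by have := QX1 1%N isT; rewrite expr1.
have C1E : C 1%N = (Q - 1) / Q by rewrite /C; field.
have C2E : C 2%N = (Q ^+ 2 - 1) / Q ^+ 2 by rewrite /C; field.
have Qn0 : Q ^+ n0 != 0 by rewrite expf_neq0.
rewrite N2E W_E expE C1E C2E; split=> [ne m_gt2|ne ->|eq_n].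
- by rewrite m_gt2 (ltnW m_gt2); field; rewrite -/Q Q0 Qn0.
(* For p^s = 2 only the squares exhaust their factor; dividing by C 1 = (q - 1)/q produces the
   coefficient q/(q - 1). *)
- by rewrite /=; field; rewrite -/Q Q0 Qn0 sub1.
(* Now X^n - 1 is separable: the squares disappear, and the other two terms are divided by C 2 and
   (C 1)^2, whose powers of q cancel the global q^-2. *)
have -> : (p ^ s)%N = 1%N by apply/eqP; rewrite -(eqn_pmul2r n0_gt0) mul1n -n_eq eq_n.
by rewrite eq_n /=; field; rewrite -/Q (QX1 2%N) // sub1 Q0 Qn0.
Qed.
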